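(* Let $r\ge 1$ be an integer and let $G_1,\dots,G_r:\mathbb{R}\to[0,1]$ be right-continuous, monotone non-decreasing functions with $\lim_{x\to-\infty}G_i(x)=0$, $\lim_{x\to\infty}G_i(x)=1$, and $G_i(x)=1-G_i(-x)$ for all $x\in\mathbb{R}$, $i=1,\dots,r$. Let $a_1,\dots,a_{r-1}>0$ and set $a_r=\left(\prod_{i=1}^{r-1}a_i\right)^{-1}$ (with the empty product equal to $1$, so $a_1=1$ when $r=1$). Then $$\mathbf{G}=2^{r-2}\int_{-a_1}^{a_1}\int_{-a_2}^{a_2}\cdots\int_{-a_r}^{a_r}\Phi\!\left(-\prod_{i=1}^{r}x_i^2,\;2-r,\;\tfrac12\right)\prod_{i=1}^{r}G_i(x_i)\,dx_1\cdots dx_r,$$ where $\mathbf{G}=\sum_{n=0}^{\infty}\frac{(-1)^n}{(2n+1)^2}$ is Catalan's constant and $\Phi$ is the Lerch transcendent.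
   Context: Catalan's constant is $\mathbf{G}=\sum_{n=0}^{\infty}\frac{(-1)^n}{(2n+1)^2}$. The Lerch transcendent is $\Phi(z,s,a)=\sum_{k=0}^{\infty}\frac{z^k}{(k+a)^s}$ for $a>0$, where the series converges (e.g. $|z|<1$); for other values of $z$ it is understood via its analytic continuation in $z$ (for $s$ a non-positive integer, $\Phi(z,s,\tfrac12)$ is a rational function of $z$ whose only pole is at $z=1$, e.g. $\Phi(-z,-1,\tfrac12)=\frac{1-z}{2(1+z)^2}$). *)

(* Defs.v *)
From mathcomp Require Import all_boot all_order all_algebra.
From mathcomp Require Import complex.
From mathcomp Require Import all_classical all_reals all_analysis.

Set Implicit Arguments.
Unset Strict Implicit.
Unset Printing Implicit Defensive.

Import Order.TTheory GRing.Theory Num.Theory.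
Import numFieldNormedType.Exports.

Local Open Scope classical_set_scope.
Local Open Scope ring_scope.
Local Open Scope complex_scope.

Definition catalan (R : realType) : R :=
  limn (series (fun n : nat => (-1) ^+ n / (2 * n + 1)%N%:R ^+ 2 : R)).

(* Partial sums of \sum_k z ^ k / (k + a) ^ s. The alias R[i]^o is what carries
   the topology of the complex plane. *)
Definition lerch_series (R : realType) (z : R[i]) (s a : R) : nat -> R[i]^o :=
  series (fun k : nat => z ^+ k / (((k%:R + a) `^ s)%:C) : R[i]^o).

(* [1 <= z] in the partial order of R[i] says that z is real and at least 1, so
   the domain of holomorphy is the plane cut along [1, +oo[. It is connected,
   hence f is determined on it by the series; outside of it f is arbitrary. *)
Definition is_lerch_continuation (R : realType) (s a : R)
    (f : R[i]^o -> R[i]^o) : Prop :=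
  (forall z : R[i], ~ (1 <= z) -> derivable f z 1) /\
  (forall z : R[i], `|z| < 1 -> f z = limn (lerch_series z s a)).

(* The Lerch transcendent, for real s and a > 0: the sum of the series where it
   converges, its analytic continuation in z elsewhere. The value is
   unspecified for those z on the cut [1, +oo[ where the series diverges. *)
Definition lerch (R : realType) (z : R[i]) (s a : R) : R[i] :=
  if `[< cvgn (lerch_series z s a) >] then limn (lerch_series z s a)
  else xget (fun=> 0) [set f | is_lerch_continuation s a f] z.

(* \int_(-a_0)^(a_0) ... \int_(-a_(r-1))^(a_(r-1)) F (x_0, ..., x_(r-1)), as
   successive Lebesgue integrals, the first coordinate being the outermost. *)
Fixpoint box_integral (R : realType) (r : nat) :
    ('I_r -> R) -> (r.-tuple R -> \bar R) -> \bar R :=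
  match r return ('I_r -> R) -> (r.-tuple R -> \bar R) -> \bar R with
  | 0 => fun _ F => F [tuple]
  | r'.+1 => fun a F =>
      (\int[@lebesgue_measure R]_(t in `[(- a ord0)%R, a ord0])
         box_integral (fun i => a (lift ord0 i))
                      (fun x : r'.-tuple R => F [tuple of t :: x]))%E
  end.

(* Main.v *)
(** Since the box has [\prod_i a_i = 1], the argument [- \prod_i x_i ^ 2] of
    [lerch] lies in the open unit disc except at the corners of the box: only
    the power series matters, never the analytic continuation.

    As [G_i x + G_i (- x) = 1], integrating an even function against [G_i] over
    [[- a_i, a_i]] gives its integral over [[0, a_i]]. Applied termwise, the
    integral in one variable multiplies the [k]-th coefficient of the series by
    [a_i ^ (2 k + 1) / (2 k + 1)], so [r] integrals turn
    [(-1) ^ k (k + 1/2) ^ (r - 2)] into [2 ^ (2 - r) (-1) ^ k / (2 k + 1) ^ 2].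
    Absolute convergence after all the integrations gives the absolute
    convergence needed at each inner one, because [(2 k + 1) q ^ k] is bounded
    for [0 <= q < 1]. *)
Require Import Defs.
From mathcomp Require Import all_boot all_order all_algebra.
From mathcomp Require Import complex.
From mathcomp Require Import all_classical all_reals all_analysis.
From mathcomp Require Import measurable_realfun.
From mathcomp Require Import ring lra.

Set Implicit Arguments.
Unset Strict Implicit.
Unset Printing Implicit Defensive.

Import Order.TTheory GRing.Theory Num.Theory.
Import numFieldNormedType.Exports.

Local Open Scope classical_set_scope.
Local Open Scope ring_scope.
Local Open Scope complex_scope.

(** * Even powers integrated against a symmetric distribution function *)

(** The interval is open because the series integrated later is only controlled for [|t| < a]. The
    fundamental theorem of calculus is applied on the closed one. *)
Lemma integral_even_power (R : realType) (a : R) (k : nat) : 0 < a ->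
  (\int[lebesgue_measure]_(x in `](- a)%R, a[) (x ^+ k.*2)%:E =
   (a * (a ^+ 2) ^+ k / k.*2.+1%:R *+ 2)%:E)%E.
Proof.
move=> a0.
have mX : measurable_fun `]- a, a[ (fun x : R => (x ^+ k.*2)%:E).
  by apply/measurable_EFinP; exact: exprn_measurable.
rewrite -(integral_itv_bndoo true false mX).
pose F (x : R) := x ^+ k.*2.+1 / k.*2.+1%:R.
have dF (x : R) : is_derive x 1 F (x ^+ k.*2).
  rewrite (_ : F = k.*2.+1%:R^-1 *: (@id R ^+ k.*2.+1)); last first.
    by apply/funext => y; rewrite /F [RHS]/GRing.scale/= fctE/= mulrC.
  apply: is_derive_eq.
  by rewrite /GRing.scale/= mulr1 mulrA mulVf ?mul1r// pnatr_eq0.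
rewrite (@continuous_FTC2 _ _ F)//.
- rewrite -EFinB /F exprNn -signr_odd/= odd_double/= expr1 mulN1r mulNr opprK.
  by rewrite exprS -mul2n exprM -mulr2n.
- by rewrite gtrN.
- apply: continuous_subspaceT => x; exact: exprn_continuous.
- split.
  + by move=> x _; apply: (@ex_derive _ _ _ _ _ _ _ (dF x)).
  + apply: cvg_at_right_filter.
    apply/differentiable_continuous/derivable1_diffP.
    exact: (@ex_derive _ _ _ _ _ _ _ (dF (- a))).
  + apply: cvg_at_left_filter.
    apply/differentiable_continuous/derivable1_diffP.
    exact: (@ex_derive _ _ _ _ _ _ _ (dF a)).
- by move=> x _; rewrite derive1E (@derive_val _ _ _ _ _ _ _ (dF x)).
Qed.

(** Lebesgue measure is its own pushforward under negation, which also preserves the interval. *)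
Lemma integral_symmetric (R : realType) (a : R) (f : R -> \bar R) :
  measurable_fun `]- a, a[ f -> (forall x, (0 <= f x)%E) ->
  (\int[lebesgue_measure]_(x in `](- a)%R, a[) f (- x)%R =
   \int[lebesgue_measure]_(x in `](- a)%R, a[) f x)%E.
Proof.
move=> mf f0.
have aN : (-%R : _ -> measurableTypeR R) @^-1` `]- a, a[ = `]- a, a[%classic.
  by apply/seteqP; split => x /=; rewrite !in_itv/= ltrN2 ltrNl andbC.
rewrite -[in LHS]aN -[LHS]ge0_integral_pushforward//=.
by apply: eq_measure_integral => //= A mA AS; exact: lebesgue_measureN.
Qed.

(** Adding the integral to its reflection replaces the weight by [G x + G (- x) = 1], so twice the
    integral is the unweighted one. *)
Lemma integral_even_power_cdf (R : realType) (a : R) (k : nat) (G : R -> R) :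
  0 < a -> (forall x, 0 <= G x) -> measurable_fun setT G ->
  (forall x, G x = 1 - G (- x)) ->
  (\int[lebesgue_measure]_(x in `](- a)%R, a[) (x ^+ k.*2 * G x)%:E =
   (a * (a ^+ 2) ^+ k / k.*2.+1%:R)%:E)%E.
Proof.
move=> a0 G0 mG Gs; set I := LHS.
have mI : measurable_fun `]- a, a[%classic (fun x => (x ^+ k.*2 * G x)%:E).
  apply/measurable_EFinP; apply: measurable_funM; first exact: exprn_measurable.
  exact: measurable_funTS.
have f0 (x : R) : (0 <= (x ^+ k.*2 * G x)%:E)%E.
  by rewrite lee_fin mulr_ge0// exprn_even_ge0// odd_double.
have I0 : (0 <= I)%E by exact: integral_ge0.
have : (I + I = (a * (a ^+ 2) ^+ k / k.*2.+1%:R *+ 2)%:E)%E.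
  rewrite -integral_even_power// {2}/I -integral_symmetric// -ge0_integralD//=.
  - apply: eq_integral => x _; rewrite -EFinD exprNn -signr_odd odd_double/=.
    by rewrite mul1r -mulrDr [G x]Gs subrK mulr1.
  - apply/measurable_EFinP; apply: measurable_funM.
      by apply: measurable_funX; exact: oppr_measurable.
    by apply: measurable_funTS; apply: measurableT_comp => //;
      exact: oppr_measurable.
(* Halving is done in the reals: [0 <= I] excludes -oo, and the finite value of [I + I] excludes
   +oo. *)
move: I0; case: I => [r| |]//= _ [] /eqP.
by rewrite -mulr2n eqrMn2r/= => /eqP ->.
Qed.

(** * Convergence inside the interval from convergence after integration *)

(** Each of the k terms of 1 + q + ... + q^(k-1) is at least q^k; multiplying by 1 - q sums the
    progression without a division. *)
Lemma natr_mul_expr_le (R : realDomainType) (q : R) (k : nat) :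
  0 <= q <= 1 -> k%:R * q ^+ k * (1 - q) <= 1 - q ^+ k.
Proof.
move=> /andP[q0 q1]; elim: k => [|k IH]; first by rewrite !mul0r expr0 subrr.
have qk : q ^+ k.+1 <= 1 by exact: exprn_ile1.
move: (ler_wpM2l q0 IH) qk; rewrite exprS -natr1.
set x := q ^+ k; set n := k%:R => IHq qk.
(* This product is exactly the slack between [q] times the induction hypothesis and the goal. *)
have : 0 <= (1 - q) * (1 - q * x) by rewrite mulr_ge0 ?subr_ge0.
lra.
Qed.

(** Undoes one integration: the lost factor 1 / (2k + 1) is paid for by moving strictly inside the
    interval, where t^2 = a^2 q with q < 1. *)
Lemma cvg_series_even_power (R : realType) (c : R ^nat) (a t : R) :
  (forall k, 0 <= c k) -> `|t| < a ->
  cvgn (series (fun k => c k * (a ^+ 2) ^+ k / k.*2.+1%:R)) ->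
  cvgn (series (fun k => c k * (t ^+ 2) ^+ k)).
Proof.
move=> c0 ta cv; have a0 : 0 < a by exact: le_lt_trans ta.
pose q := t ^+ 2 / a ^+ 2.
have a20 : 0 < a ^+ 2 by exact: exprn_gt0.
have tq : t ^+ 2 = a ^+ 2 * q by rewrite /q mulrC divfK// gt_eqF.
have q0 : 0 <= q by rewrite divr_ge0// sqr_ge0.
have q1 : q < 1.
  by rewrite ltr_pdivrMr// mul1r -real_normK ?num_real// ltr_pXn2r// nnegrE ltW.
(* Bounds (2k + 1) q^k: the first summand bounds 2k q^k, the second q^k. *)
pose C := 2 / (1 - q) + 1.
apply: (@series_le_cvg _ _ (C *: (fun k => c k * (a ^+ 2) ^+ k / k.*2.+1%:R))).
- by move=> k; rewrite mulr_ge0// exprn_ge0// sqr_ge0.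
- move=> k; rewrite [leRHS](_ : _ = C * (c k * (a ^+ 2) ^+ k / k.*2.+1%:R))//.
  rewrite mulr_ge0 ?divr_ge0 ?mulr_ge0 ?exprn_ge0 ?(ltW a0)//.
  by rewrite addr_ge0// divr_ge0// subr_ge0 ltW.
- move=> k; rewrite [leRHS](_ : _ = C * (c k * (a ^+ 2) ^+ k / k.*2.+1%:R))//.
  have -> : C * (c k * (a ^+ 2) ^+ k / k.*2.+1%:R) =
            c k * (a ^+ 2) ^+ k * (k.*2.+1%:R^-1 * C) by ring.
  rewrite tq exprMn mulrA ler_wpM2l//; first by rewrite mulr_ge0// exprn_ge0// ltW.
  rewrite ler_pdivlMl ?ltr0n//.
  have := @natr_mul_expr_le _ q k; rewrite q0 (ltW q1) => /(_ isT) h.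
  have qk0 : 0 <= q ^+ k by exact: exprn_ge0.
  have qk1 : q ^+ k <= 1 by apply: exprn_ile1 => //; exact: ltW.
  have {}h : k%:R * q ^+ k <= (1 - q)^-1.
    rewrite -[leRHS]mul1r ler_pdivlMr ?subr_gt0//; lra.
  rewrite -natr1 -muln2 natrM /C; lra.
- exact: is_cvg_seriesZ.
Qed.

(** * Termwise integration in one variable *)

(** Dominated convergence for the partial sums [fn], with the series of absolute values [g] as
    bound. [J] is prescribed only inside the interval, since the series may diverge at the
    endpoints, a null set. *)
Lemma integral_even_series_cdf (R : realType) (a : R) (c : R ^nat)
    (G : R -> R) (J : R -> \bar R) :
  0 < a -> (forall x, 0 <= G x <= 1) -> measurable_fun setT G ->
  (forall x, G x = 1 - G (- x)) ->
  cvgn (series (fun k => `|c k| * (a ^+ 2) ^+ k / k.*2.+1%:R)) ->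
  (forall t, `|t| < a ->
    J t = (limn (series (fun k => c k * (t ^+ 2) ^+ k)) * G t)%:E) ->
  (\int[lebesgue_measure]_(x in `[(- a)%R, a]) J x =
   (a * limn (series (fun k => c k * (a ^+ 2) ^+ k / k.*2.+1%:R)))%:E)%E.
Proof.
move=> a0 G01 mG Gs cv JE.
pose f t := limn (series (fun k => c k * (t ^+ 2) ^+ k)).
pose fn n x := (\sum_(0 <= k < n) c k * (x ^+ 2) ^+ k) * G x.
pose g (x : R) : \bar R := (\sum_(k <oo) (`|c k| * x ^+ k.*2)%:E)%E.
have xa x : x \in `]- a, a[%classic -> `|x| < a.
  by rewrite inE/= in_itv/= -ltr_norml.
have x2k (x : R) k : x ^+ k.*2 = (x ^+ 2) ^+ k by rewrite -exprM mul2n.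
have cvs x : `|x| < a -> cvgn (series (fun k => `|c k| * (x ^+ 2) ^+ k)).
  by move=> ?; apply: cvg_series_even_power cv.
have mfn n : measurable_fun `]- a, a[%classic (fn n).
  apply: measurable_funM; last exact: measurable_funTS.
  apply: measurable_sum => k; apply: measurable_funM => //.
  by do 2 apply: measurable_funX.
have fn_f x : `|x| < a -> fn ^~ x @ \oo --> f x * G x.
  move=> xa'; apply: cvgMl.
  apply: normed_cvg; rewrite /= [X in cvgn (series X)](_ : _ =
    (fun k => `|c k| * (x ^+ 2) ^+ k)); first exact: cvs.
  by apply/funext => k /=; rewrite normrM [X in _ * X]ger0_norm// exprn_ge0// sqr_ge0.
have mf : measurable_fun `]- a, a[%classic (fun x => f x * G x).
  apply: (measurable_fun_cvg mfn) => x xI; apply: fn_f; apply: xa; rewrite inE//.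
have mfE : measurable_fun `]- a, a[%classic (fun x => (f x * G x)%:E).
  exact/measurable_EFinP.
rewrite (integral_itv_bndoo true false); last first.
  by apply: eq_measurable_fun mfE => x /xa /JE ->.
under eq_integral => x xI do rewrite JE ?xa//.

have mcx k : measurable_fun `]- a, a[%classic (fun x => (`|c k| * x ^+ k.*2)%:E).
  apply/measurable_EFinP; apply: measurable_funM => //; exact: measurable_funX.
have cx0 k x : (0 <= (`|c k| * x ^+ k.*2)%:E)%E.
  by rewrite lee_fin mulr_ge0// exprn_even_ge0// odd_double.
(* By monotone convergence, the integral of [g] is 2a times the sum of the series in [cv]. *)
have ig : lebesgue_measure.-integrable `]- a, a[ g.
  apply/integrableP; split.
    by apply: (@ge0_emeasurable_sum _ _ _ _
      (fun k (x : R) => (`|c k| * x ^+ k.*2)%:E) xpredT) => *.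
  under eq_integral do rewrite gee0_abs ?nneseries_ge0//.
  rewrite integral_nneseries//.
  rewrite [ltLHS](_ : _ = limn (EFin \o series
    (a *+ 2 *: (fun k => `|c k| * (a ^+ 2) ^+ k / k.*2.+1%:R)))).
    rewrite EFin_lim ?ltry//; exact: is_cvg_seriesZ.
  congr (limn _); apply/funext => n /=; rewrite /series/= -sumEFin.
  apply: eq_bigr => k _.
  under eq_integral do rewrite EFinM.
  rewrite ge0_integralZl//= ?lee_fin//; last 2 first.
  - by apply/measurable_EFinP; exact: measurable_funX.
  - by move=> x _; rewrite lee_fin exprn_even_ge0// odd_double.
  rewrite integral_even_power// -EFinM; congr EFin.
  rewrite [RHS](_ : _ = a *+ 2 * (`|c k| * (a ^+ 2) ^+ k / k.*2.+1%:R))//.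
  ring.
have mfnE n : measurable_fun `]- a, a[%classic (EFin \o fn n).
  exact/measurable_EFinP.
(* The weight disappears from the bound because [G x <= 1]. *)
have fng x n : (`|(fn n x)%:E| <= g x)%E.
  have h : (\sum_(0 <= k < n) (`|c k| * x ^+ k.*2)%:E <= g x)%E.
    by apply: nneseries_lim_ge => *.
  apply: le_trans h.
  have /andP[G0 G1] := G01 x.
  rewrite abse_EFin /fn normrM sumEFin lee_fin -[leRHS]mulr1.
  rewrite ler_pM ?normr_ge0 ?[`|G x|]ger0_norm//.
  apply: (le_trans (ler_norm_sum _ _ _)); apply: ler_sum => k _.
  by rewrite normrM x2k [X in _ * X]ger0_norm// exprn_ge0// sqr_ge0.
have [||||||_ _] := @dominated_convergence _ _ _ lebesgue_measure
  `]- a, a[%classic _ (fun n => EFin \o fn n) (fun x => (f x * G x)%:E) g.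
- exact: measurable_itv.
- exact: mfnE.
- exact: mfE.
- apply/aeW => x xI; apply/cvg_EFin; first by near=> n.
  by apply: fn_f; apply: xa; rewrite inE.
- exact: ig.
- by apply/aeW => x n _; exact: fng.
pose s k := c k * (a ^+ 2) ^+ k / k.*2.+1%:R.
have mxG k : measurable_fun `]- a, a[%classic (fun x : R => (x ^+ k.*2 * G x)%:E).
  apply/measurable_EFinP; apply: measurable_funM; first exact: exprn_measurable.
  exact: measurable_funTS.
have G0 x : 0 <= G x by have /andP[] := G01 x.
have ixG k : lebesgue_measure.-integrable `]- a, a[ (fun x : R => (x ^+ k.*2 * G x)%:E).
  apply/integrableP; split; first exact: mxG.
  under eq_integral do rewrite gee0_abs ?lee_fin ?mulr_ge0// ?exprn_even_ge0 ?odd_double//.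
  by rewrite integral_even_power_cdf// ltry.
rewrite (_ : [sequence _]_n = EFin \o (fun n => a * series s n)); last first.
  apply/funext => n /=; rewrite /fn.
  transitivity (\int[lebesgue_measure]_(x in `](- a)%R, a[)
      (\sum_(0 <= k < n) (c k)%:E * (x ^+ k.*2 * G x)%:E))%E.
    apply: eq_integral => x _; rewrite sumEFin mulr_suml; congr EFin.
    by apply: eq_bigr => k _; rewrite x2k mulrA.
  rewrite integral_sum//=; last by move=> k; exact: integrableZl.
  rewrite /series/= mulr_sumr -sumEFin; apply: eq_bigr => k _.
  rewrite integralZl// integral_even_power_cdf// -EFinM; congr EFin.
  rewrite /s; ring.
move=> /cvg_lim <-//; apply/cvg_lim => //; apply: cvg_EFin; first by near=> n.
apply: cvgMr.
apply: normed_cvg; rewrite /= [X in cvgn (series X)](_ : _ =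
  (fun k => `|c k| * (a ^+ 2) ^+ k / k.*2.+1%:R))//.
by apply/funext => k /=; rewrite /s normrM normrM [`|_^-1|]ger0_norm//
  [`|_ ^+ k|]ger0_norm// exprn_ge0// sqr_ge0.
Unshelve. all: by end_near.
Qed.

(** * Iterated integrals over the box *)

Lemma lim_seriesMl (R : realType) (k : R) (u : R ^nat) : cvgn (series u) ->
  limn (series (fun n => k * u n)) = k * limn (series u).
Proof. by move=> cu; rewrite -[LHS]/(limn (series (k *: u))) lim_seriesZ. Qed.

Lemma is_cvg_seriesMl (R : realType) (k : R) (u : R ^nat) : cvgn (series u) ->
  cvgn (series (fun n => k * u n)).
Proof. exact: is_cvg_seriesZ. Qed.

(* For [n > 0] nothing is assumed of [F] at [\prod_i a_i ^ 2], the value reached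
   at the corners of the box; for [n = 0] it is the only value that occurs. *)
Lemma box_integral_even_series (R : realType) (n : nat) (a : 'I_n -> R)
    (G : 'I_n -> R -> R) (u : R ^nat) (F : R -> R) (K : R) :
  (forall i, 0 < a i) ->
  (forall i x, 0 <= G i x <= 1) ->
  (forall i, measurable_fun setT (G i)) ->
  (forall i x, G i x = 1 - G i (- x)) ->
  cvgn (series (fun k => `|u k| * (\prod_i a i ^+ 2) ^+ k / k.*2.+1%:R ^+ n)) ->
  (forall y, 0 <= y -> y < \prod_i a i ^+ 2 ?<= if (n == 0)%N ->
     F y = limn (series (fun k => u k * y ^+ k))) ->
  (box_integral a (fun x : n.-tuple R =>
     (K * F (\prod_i tnth x i ^+ 2) * \prod_i G i (tnth x i))%:E) =
   (K * \prod_i a i * limn (series (fun k =>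
     u k * (\prod_i a i ^+ 2) ^+ k / k.*2.+1%:R ^+ n)))%:E)%E.
Proof.
elim: n a G u F K => [|n IH] a G u F K a0 G01 mG Gs.
  move=> _ FE /=; rewrite !big_ord0 !mulr1 in FE *.
  rewrite FE//=; congr (K * limn (series _))%:E.
  by apply/funext => k; rewrite expr0 divr1.
rewrite !big_ord_recl /=.
set P := \prod_(i < n) a (lift ord0 i) ^+ 2.
set A := \prod_(i < n) a (lift ord0 i).
set b := a ord0 => cv FE.
have b0 : 0 < b by exact: a0.
have P0 : 0 < P by apply: prodr_gt0 => i _; exact: exprn_gt0.
have A0 : 0 < A by apply: prodr_gt0.
have m0 k : 0 < k.*2.+1%:R :> R by rewrite ltr0n.
(* Coefficients in the outermost variable, once all the inner ones are integrated. *)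
pose w k := u k * P ^+ k / k.*2.+1%:R ^+ n.
have divMM (x y z p q : R) : x * (y * z) / (p * q) = x * z / q * y / p.
  by rewrite invfM; ring.
have normw k : `|w k| = `|u k| * P ^+ k / k.*2.+1%:R ^+ n.
  by rewrite /w normrM normrM [`|_^-1|]ger0_norm
    ?[`|_ ^+ k|]ger0_norm// ?invr_ge0 exprn_ge0// ltW.
have cvw : cvgn (series (fun k => `|w k| * (b ^+ 2) ^+ k / k.*2.+1%:R)).
  rewrite (_ : (fun k => _) =
    (fun k => `|u k| * (b ^+ 2 * P) ^+ k / k.*2.+1%:R ^+ n.+1))//.
  apply/funext => k; rewrite normw (exprMn k (b ^+ 2) P) (exprS _ n).
  by rewrite divMM.
have cvt t : `|t| < b -> cvgn (series (fun k => `|w k| * (t ^+ 2) ^+ k)).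
  by move=> tb; apply: (cvg_series_even_power _ tb cvw) => k.
rewrite (@integral_even_series_cdf _ b (fun k => K * A * w k) (G ord0))//.
- rewrite [K * (b * A)]mulrCA -mulrA -(lim_seriesMl (K * A)).
    congr (b * limn (series _))%:E; apply/funext => k.
    by rewrite (exprMn k (b ^+ 2) P) (exprS _ n) divMM -/(w k) !mulrA.
  apply/normed_cvg; rewrite /= [X in cvgn (series X)](_ : _ =
    (fun k => `|u k| * (b ^+ 2 * P) ^+ k / k.*2.+1%:R ^+ n.+1))//.
  apply/funext => k /=; rewrite normrM normrM [`|_^-1|]ger0_norm//.
  by rewrite [`|_ ^+ k|]ger0_norm// exprn_ge0// mulr_ge0 ?sqr_ge0 ?ltW.
- rewrite (_ : (fun k => _) =
    (fun k => `|K * A| * (`|w k| * (b ^+ 2) ^+ k / k.*2.+1%:R))).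
    exact: is_cvg_seriesMl.
  by apply/funext => k; rewrite normrM !mulrA.
- move=> t tb.
  have tb2 : t ^+ 2 < b ^+ 2.
    by rewrite -real_normK ?num_real// ltr_pXn2r// nnegrE ltW.
  have t20 : 0 <= t ^+ 2 by exact: sqr_ge0.
  (* For fixed [t] the inner integral has the same shape: (t^2)^k goes into the coefficients, t^2
     into the argument of [F], and [G ord0 t] into the constant. This is why the induction
     generalizes over [u], [F] and [K]. *)
  pose v k := u k * (t ^+ 2) ^+ k.
  have vw k : v k * P ^+ k / k.*2.+1%:R ^+ n = w k * (t ^+ 2) ^+ k.
    by rewrite /v /w; ring.
  have IHt := IH (fun i => a (lift ord0 i)) (fun i => G (lift ord0 i)) v
    (fun y => F (t ^+ 2 * y)) (K * G ord0 t).
  transitivity (K * G ord0 t * A * limn (series (fun k => w k * (t ^+ 2) ^+ k)))%:E.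
    rewrite -[in RHS](funext vw) -IHt//.
    - congr box_integral; apply/funext => x; rewrite !big_ord_recl/= !tnth0.
      rewrite (eq_bigr (fun i => tnth x i ^+ 2)); last by move=> i _; rewrite tnthS.
      rewrite [X in _ * (_ * X)](eq_bigr (fun i => G (lift ord0 i) (tnth x i))); last first.
        by move=> i _; rewrite tnthS.
      by congr EFin; ring.
    - rewrite (_ : (fun k => _) = (fun k => `|w k| * (t ^+ 2) ^+ k)); first exact: cvt.
      apply/funext => k; rewrite normw /v normrM (ger0_norm (exprn_ge0 _ t20)).
      by ring.
    (* Strictness comes from the outer variable, t^2 < b^2, so the inner corner y = P is also
       allowed. *)
    - move=> y y0 yP; rewrite FE.
      + by congr (limn (series _)); apply/funext => k; rewrite exprMn mulrA.
      + exact: mulr_ge0.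
      + rewrite /=; apply: (@le_lt_trans _ _ (t ^+ 2 * P)).
          by rewrite ler_wpM2l//; apply: lteifW yP.
        by rewrite ltr_pM2r.
  rewrite (_ : (fun k => K * A * w k * _) = (fun k => K * A * (w k * (t ^+ 2) ^+ k))).
    rewrite lim_seriesMl; first by congr EFin; ring.
    apply: normed_cvg; rewrite /= [X in cvgn (series X)](_ : _ =
      (fun k => `|w k| * (t ^+ 2) ^+ k)); first exact: cvt.
    by apply/funext => k /=; rewrite normrM (ger0_norm (exprn_ge0 _ t20)).
  by apply/funext => k; rewrite !mulrA.
Qed.

(** * The Lerch series at real arguments, and its coefficients *)

Lemma cvgn_real_complex (R : realType) (u : R ^nat) (l : R) :
  u @ \oo --> l -> ((fun n => (u n)%:C) : nat -> R[i]^o) @ \oo --> (l%:C : R[i]^o).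
Proof.
(* A positive element of [R[i]] is real, so complex radii reduce to real ones. *)
move=> /cvgrPdist_lt ul; apply/cvgrPdist_lt => e e0.
have /andP[/eqP ie re] : (complex.Im e == 0) && (0 < complex.Re e).
  by move: e0; rewrite ltcE/= => /andP[/eqP <- ->]; rewrite eqxx.
have eE : e = (complex.Re e)%:C by rewrite [LHS]complexE ie mulr0 addr0.
near=> n; rewrite -rmorphB/= normc_def/= expr0n addr0 sqrtr_sqr eE ltcR.
by near: n; exact: ul.
Unshelve. all: by end_near.
Qed.

(** Convergence of the real series selects the first branch of [lerch]; all partial sums are real,
    so taking [Re] loses nothing. *)
Lemma lerch_real (R : realType) (y s b : R) :
  cvgn (series (fun k => y ^+ k / (k%:R + b) `^ s)) ->
  complex.Re (lerch y%:C s b) = limn (series (fun k => y ^+ k / (k%:R + b) `^ s)).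
Proof.
move=> cu.
have lE : lerch_series y%:C s b =
    (fun n => (series (fun k => y ^+ k / (k%:R + b) `^ s) n)%:C).
  apply/funext => n; rewrite /lerch_series /series/= rmorph_sum/=.
  by apply: eq_bigr => k _; rewrite rmorphM/= fmorphV rmorphXn.
have cl := cvgn_real_complex cu.
rewrite /lerch lE asboolT; last by apply/cvg_ex; eexists; exact: cl.
by rewrite (cvg_lim _ cl)//; exact: norm_hausdorff.
Qed.

Lemma cvg_series_inv_odd_sqr (R : realType) :
  cvgn (series (fun k => (k.*2.+1%:R ^+ 2)^-1 : R)).
Proof.
apply: nondecreasing_is_cvgn.
  by apply/nondecreasing_series => k _ _; rewrite invr_ge0 exprn_ge0.
exists 2 => _ [n _ <-].
(* Telescoping bound: 1 / (2n + 1)^2 is at most 2 / (n + 1) - 2 / (n + 2), with difference of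
   numerators 7n^2 + 5n. *)
suff: series (fun k => (k.*2.+1%:R ^+ 2)^-1 : R) n <= 2 - 2 / n.+1%:R.
  by move=> /le_trans; apply; rewrite lerBlDr lerDl divr_ge0.
elim: n => [|n IH]; first by rewrite /series/= big_geq// divr1 subrr.
rewrite seriesSr; apply: le_trans (lerD IH (lexx _)) _.
rewrite -muln2 -!natr1 natrM; set x := n%:R; have x0 : 0 <= x by [].
rewrite -subr_ge0 [X in 0 <= X](_ : _ =
    (7 * x ^+ 2 + 5 * x) / ((x + 1) * (x + 1 + 1) * (x * 2 + 1) ^+ 2)).
  by rewrite divr_ge0 ?mulr_ge0 ?exprn_ge0 ?addr_ge0 ?mulr_ge0 ?exprn_ge0.
by field; rewrite !gt_eqF//; lra.
Qed.

(** As k + 1/2 = (2k + 1) / 2, the coefficient contains (2k + 1)^(r - 2); the r divisions leave the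
    exponent -2 whatever r is. *)
Lemma half_odd_powR (R : realType) (r k : nat) :
  ((-1) ^+ k / (k%:R + 2^-1) `^ (2 - r%:R)) / k.*2.+1%:R ^+ r =
  (2 : R) ^ (2 - r%:Z) * ((-1) ^+ k / k.*2.+1%:R ^+ 2).
Proof.
have m0 : (k.*2.+1%:R : R) != 0 by rewrite pnatr_eq0.
have h0 : k.*2.+1%:R / 2 != 0 :> R by rewrite mulf_neq0.
have -> : k%:R + 2^-1 = k.*2.+1%:R / 2 :> R.
  by rewrite -[k.*2.+1%:R]natr1 -muln2 natrM; field.
rewrite powRB ?h0 ?implybT// !powR_mulrn// expfzDr// -exprnN -exprnP.
rewrite !expr_div_n !invfM !invrK.
move: (k.*2.+1%:R) m0 {h0} => m m0.
have m0r := expf_neq0 r m0.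
have t0r : (2 : R) ^+ r != 0 by rewrite expf_neq0.
move: m0r t0r; move: (m ^+ r) (2 ^+ r) => p q p0 q0.
by field; rewrite m0 p0 q0.
Qed.

(* Removes one factor [1 / (2 k + 1)] at a time, at the price of passing from
   [y] to [sqrt y]. *)
Lemma cvg_series_power (R : realType) (n : nat) (u : R ^nat) (y : R) :
  cvgn (series (fun k => `|u k| / k.*2.+1%:R ^+ n)) -> 0 <= y < 1 ->
  cvgn (series (fun k => `|u k| * y ^+ k)).
Proof.
elim: n u y => [|n IH] u y cu /andP[y0 y1].
  apply: series_le_cvg cu => k; rewrite ?expr0 ?divr1 ?mulr_ge0 ?exprn_ge0//.
  by rewrite ler_piMr// exprn_ile1// ltW.
have s1 : Num.sqrt y < 1 by rewrite -sqrtr1 ltr_sqrt.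
have ss1 : Num.sqrt (Num.sqrt y) < 1 by rewrite -sqrtr1 ltr_sqrt.
have -> : (fun k => `|u k| * y ^+ k) =
    (fun k => `|u k * Num.sqrt y ^+ k| * Num.sqrt y ^+ k).
  apply/funext => k; rewrite normrM [`|_ ^+ k|]ger0_norm ?exprn_ge0// -mulrA.
  by rewrite -exprMn -expr2 sqr_sqrtr.
apply: IH; last by rewrite sqrtr_ge0.
(* To apply [cvg_series_even_power] with a = 1, sqrt y is written as t^2 with t = sqrt (sqrt y) <
   1. *)
have -> : (fun k => `|u k * Num.sqrt y ^+ k| / k.*2.+1%:R ^+ n) =
    (fun k => `|u k| / k.*2.+1%:R ^+ n * (Num.sqrt (Num.sqrt y) ^+ 2) ^+ k).
  apply/funext => k; rewrite sqr_sqrtr// normrM [`|_ ^+ k|]ger0_norm ?exprn_ge0//.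
  by rewrite mulrAC.
apply: (@cvg_series_even_power _ _ 1) => [k||].
- by rewrite divr_ge0.
- by rewrite ger0_norm.
- rewrite (_ : (fun k => _) = (fun k => `|u k| / k.*2.+1%:R ^+ n.+1))//.
  by apply/funext => k; rewrite !expr1n mulr1 exprSr invfM mulrA mulrAC -mulrA.
Qed.

(** * Specialization to the Lerch transcendent *)

Theorem theorem3 (R : realType) (r : nat) (hr : (1 <= r)%N)
    (G : 'I_r -> R -> R)
    (G01 : forall i x, 0 <= G i x <= 1)
    (Grc : forall i, right_continuous (G i))
    (Gmono : forall i, {homo G i : x y / x <= y})
    (Gninfty : forall i, G i x @[x --> -oo] --> (0 : R))
    (Gpinfty : forall i, G i x @[x --> +oo] --> (1 : R))
    (Gsym : forall i x, G i x = 1 - G i (- x))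
    (a : 'I_r -> R)
    (a_gt0 : forall i : 'I_r, (i.+1 < r)%N -> 0 < a i)
    (a_last : forall i : 'I_r, i.+1 = r ->
       a i = (\prod_(j < r | (j.+1 < r)%N) a j)^-1) :
  (catalan R)%:E =
  (((2 : R) ^ (r%:Z - 2))%:E *
   box_integral a (fun x : r.-tuple R =>
     (complex.Re (lerch ((- \prod_(i < r) tnth x i ^+ 2)%:C)
                        (2 - r%:R) (2^-1)) *
      \prod_(i < r) G i (tnth x i))%:E))%E.

Proof.
case: r hr G G01 Grc Gmono Gninfty Gpinfty Gsym a a_gt0 a_last => // r _.
move=> G G01 _ Gmono _ _ Gsym a a_gt0 a_last.
have m_gt0 : 0 < \prod_(j < r.+1 | (j.+1 < r.+1)%N) a j by exact: prodr_gt0.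
have a0 i : 0 < a i.
  have [/a_gt0//|] := ltnP i.+1 r.+1.
  by move=> ri; rewrite a_last ?invr_gt0//; apply/eqP; rewrite eqn_leq ltn_ord.
have prod_a : \prod_i a i = 1.
  rewrite (bigD1 ord_max)//= (eq_bigl (fun j : 'I_r.+1 => (j.+1 < r.+1)%N)).
    by rewrite a_last// mulVf// gt_eqF.
  by move=> j; rewrite -val_eqE/= ltnS ltn_neqAle -ltnS ltn_ord andbT.
(* Hence the argument of [F] has absolute value 1 exactly at the corners of the box. *)
have prod_a2 : \prod_i a i ^+ 2 = 1 by rewrite prodrXl prod_a expr1n.
(* The sign of the argument of [lerch] is moved into the coefficients, leaving a power series in y
   >= 0. *)
pose u k : R := (-1) ^+ k / (k%:R + 2^-1) `^ (2 - r.+1%:R).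
have uE k : u k / k.*2.+1%:R ^+ r.+1 =
    (2 : R) ^ (2 - r.+1%:Z) * ((-1) ^+ k / k.*2.+1%:R ^+ 2) by exact: half_odd_powR.
have cu : cvgn (series (fun k => `|u k| / k.*2.+1%:R ^+ r.+1)).
  rewrite (_ : (fun k => _) =
      (fun k => (2 : R) ^ (2 - r.+1%:Z) * (k.*2.+1%:R ^+ 2)^-1)).
    exact/is_cvg_seriesMl/cvg_series_inv_odd_sqr.
  apply/funext => k; rewrite -[LHS]/(`|u k| / _).
  have mk : k.*2.+1%:R ^+ r.+1 = `|k.*2.+1%:R ^+ r.+1| :> R by rewrite ger0_norm.
  rewrite mk -normf_div uE normrM normf_div normrX normrN1 expr1n mul1r.
  by rewrite !ger0_norm// exprz_ge0.
have := @box_integral_even_series R r.+1 a G u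
  (fun y => complex.Re (lerch (- y)%:C (2 - r.+1%:R) 2^-1)) 1 a0 G01 _ Gsym.
rewrite prod_a prod_a2 mulr1 mul1r => H.
rewrite [X in (_ * X)%E](_ : _ =
    (limn (series (fun k => u k * 1 ^+ k / k.*2.+1%:R ^+ r.+1)))%:E).
  rewrite (_ : (fun k => _) =
      (fun k => (2 : R) ^ (2 - r.+1%:Z) * ((-1) ^+ k / k.*2.+1%:R ^+ 2))); last first.
    by apply/funext => k; rewrite expr1n mulr1 uE.
  rewrite lim_seriesMl; last first.
    apply: normed_cvg; rewrite /= [X in cvgn (series X)](_ : _ =
      (fun k => (k.*2.+1%:R ^+ 2)^-1)); first exact: cvg_series_inv_odd_sqr.
    apply/funext => k /=; rewrite normf_div normrX normrN1 expr1n mul1r.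
    by rewrite ger0_norm.
  (* The prefactor 2^(r - 2) cancels the 2^(2 - r) produced by the half-integers. *)
  rewrite -EFinM mulrA -expfzDr// addrA subrK subrr expr0z mul1r /catalan.
  congr EFin; congr (limn (series _)); apply/funext => k.
  by rewrite addn1 mul2n.
rewrite -H.
- by congr (box_integral a _); apply/funext => x; rewrite mul1r.
- by move=> i; apply: nondecreasing_measurable => //; exact: Gmono.
- rewrite (_ : (fun k => _) = (fun k => `|u k| / k.*2.+1%:R ^+ r.+1))//.
  by apply/funext => k; rewrite expr1n mulr1.
- move=> y y0 /= y1.
  have uy k : (- y) ^+ k / (k%:R + 2^-1) `^ (2 - r.+1%:R) = u k * y ^+ k.
    by rewrite exprNn /u mulrAC.
  rewrite lerch_real (funext uy)//; apply: normed_cvg => /=.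
  rewrite [X in cvgn (series X)](_ : _ = (fun k => `|u k| * y ^+ k)).
    by apply: cvg_series_power cu _; rewrite y0.
  by apply/funext => k /=; rewrite normrM [`|_ ^+ k|]ger0_norm// exprn_ge0.
Qed.
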